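(* Fix a compact length space $M$, $\epsilon>0$ and $k\in\mathbb{N}$. Then there exists $\delta=\delta_{\epsilon,k,M}>0$ such that for all $0\le a<b$: if $$(a,b)\cap L_{1/k}(M)=\emptyset,$$ then $$[a+\epsilon,b-\epsilon]\cap L_{1/k}(N)=\emptyset$$ for all compact length spaces $N$ such that $d_{GH}(N,M)<\delta$.
   Context: A compact length space is a compact metric space in which every pair of points is joined by a rectifiable curve whose length equals the distance between the points. $S^1=\mathbb{R}/2\pi\mathbb{Z}$. A closed geodesic in $M$ is a nonconstant map $\gamma:S^1\to M$ that is locally length minimizing around every point of $S^1$, parametrized proportionally to arclength with speed $L(\gamma)/(2\pi)$, where $L(\gamma)$ is its length. A $1/k$ geodesic is a closed geodesic $\gamma$ with $d(\gamma(t),\gamma(t+2\pi/k))=L(\gamma)/k$ for all $t\in S^1$. $L_{1/k}(M)$ is the set of lengths of $1/k$ geodesics in $M$. $d_{GH}$ is the Gromov–Hausdorff distance between compact metric spaces. The interval $[a+\epsilon,b-\epsilon]$ is empty if $a+\epsilon>b-\epsilon$. *)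

(* Defs.v *)
From mathcomp Require Export all_boot all_order all_algebra.
From mathcomp Require Export all_classical all_reals all_analysis.

Set Implicit Arguments.
Unset Strict Implicit.
Unset Printing Implicit Defensive.

Import Order.TTheory GRing.Theory Num.Theory.
Import numFieldNormedType.Exports.

Local Open Scope classical_set_scope.
Local Open Scope ring_scope.

(* The length of the restriction of c to [a, b]: the metric-space counterpart
   of [total_variation], with the same partitions. *)
Definition polygonal_length {R : realType} {M : metricType R}
    (a b : R) (c : R -> M) (s : seq R) : R :=
  \sum_(0 <= n < size s)
    mdist (c (nth b (a :: s) n)) (c (nth b (a :: s) n.+1)).

Definition curve_length {R : realType} {M : metricType R}
    (a b : R) (c : R -> M) : \bar R :=
  ereal_sup [set (polygonal_length a b c s)%:E | s in itv_partition a b].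

Definition compact_length_space {R : realType} (M : metricType R) : Prop :=
  compact [set: M] /\
  forall x y : M, exists c : R -> M,
    [/\ {within `[0, 1], continuous c}, c 0 = x, c 1 = y
      & curve_length 0 1 c = (mdist x y)%:E].

Definition length_minimizing {R : realType} {M : metricType R}
    (a b : R) (g : R -> M) : Prop :=
  forall (u v : R) (c : R -> M), u <= v -> {within `[u, v], continuous c} ->
    c u = g a -> c v = g b -> (curve_length a b g <= curve_length u v c)%E.

(* Maps from S^1 = R / 2 pi Z are encoded as 2 pi-periodic maps from R. *)
Definition loop_length {R : realType} {M : metricType R} (g : R -> M) : \bar R :=
  curve_length 0 (2 * pi) g.

Definition closed_geodesic {R : realType} {M : metricType R}
    (g : R -> M) : Prop :=
  [/\ continuous g, forall t, g (t + 2 * pi) = g t,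
      exists s t, g s <> g t,
      forall t, exists2 e : R, 0 < e & length_minimizing (t - e) (t + e) g
    & forall s t, s <= t ->
        curve_length s t g = (loop_length g * ((t - s) / (2 * pi))%:E)%E].

Definition one_kth_geodesic {R : realType} {M : metricType R}
    (k : nat) (g : R -> M) : Prop :=
  closed_geodesic g /\
  forall t, (mdist (g t) (g (t + 2 * pi / k%:R)))%:E
            = (loop_length g * (k%:R^-1)%:E)%E.

Definition one_kth_length_spectrum {R : realType}
    (k : nat) (M : metricType R) : set R :=
  [set l | exists2 g : R -> M, one_kth_geodesic k g & loop_length g = l%:E].

(* The infimum is +oo when exactly one of A and B is empty. *)
Definition hausdorff_dist {R : realType} {Z : metricType R}
    (A B : set Z) : \bar R :=
  ereal_inf [set r%:E | r in [set r : R | [/\ 0 < r,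
    A `<=` \bigcup_(y in B) ball y r & B `<=` \bigcup_(x in A) ball x r]]].

Definition isometric_embedding {R : realType} {X Z : metricType R}
    (f : X -> Z) : Prop :=
  forall x y, mdist (f x) (f y) = mdist x y.

Definition GH_dist {R : realType} (X Y : metricType R) : \bar R :=
  ereal_inf [set D | exists (Z : metricType R) (f : X -> Z) (g : Y -> Z),
    [/\ isometric_embedding f, isometric_embedding g
      & D = hausdorff_dist (range f) (range g)]].

(* Main.v *)
Require Import Defs.
From mathcomp Require Import ring lra.

Set Implicit Arguments.
Unset Strict Implicit.
Unset Printing Implicit Defensive.

Import Order.TTheory GRing.Theory Num.Theory.
Import numFieldNormedType.Exports.

Local Open Scope classical_set_scope.
Local Open Scope ring_scope.

(** The [1/k] condition is strong: a [1/k] geodesic [g] of length [l] has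
    constant speed, and its distance between the times [t] and [t + 2 pi / k]
    is the length of the arc between them, so by the triangle inequality every
    arc of parameter length at most [2 pi / k] is minimizing.  Being a [1/k]
    geodesic of length [l > 0] therefore says only something about the
    pseudometric [rho s t = d (g s) (g t)] on the parameter line: it vanishes
    between [t] and [t + 2 pi], it is at most [l / (2 pi) * (t - s)], and it is
    equal to this when [t - s <= 2 pi / k] ([one_kth_length_spectrumP]).  The
    scale [2 pi / k] is the same for all spaces, so these conditions survive
    pointwise limits ([short_geodesic_limit]); this fails for closed geodesics
    in general, whose minimizing arcs may shrink along a sequence.

    Suppose that no [delta] works.  Then there are spaces [N_n] converging to
    [M] and [1/k] geodesics [g_n] in [N_n] of length [l_n >= eps] such that
    [M] has no [1/k] geodesic of length in the open interval of radius [eps]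
    around [l_n].  Closeness in the Gromov-Hausdorff distance gives maps
    [N_n -> M] that distort distances by [o(1)] ([GH_dist_approximation]).
    They turn the [g_n] into maps [h_n : R -> M], not continuous in general.
    Since [M] is compact, all [h_n t] converge along one ultrafilter on the
    indices ([compact_ultrafilter_cvg]), which replaces the Arzela-Ascoli
    argument.  The pseudometric of the limit map [g] is the limit of those of
    the [g_n], so [g] is a [1/k] geodesic in [M] whose length is the limit of
    the [l_n].  That length is within [eps] of some [l_n], a contradiction. *)

(** * Lengths of curves *)

Section CurveLength.
Context {R : realType} {M : metricType R}.
Implicit Types (a b s t lam h : R) (c : R -> M) (p : seq R).

Lemma polygonal_length_cons a b x c p :
  polygonal_length a b c (x :: p)
  = mdist (c a) (c x) + polygonal_length x b c p.
Proof. by rewrite /polygonal_length /= big_nat_recl. Qed.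

Lemma polygonal_length_nil a b c : polygonal_length a b c [::] = 0.
Proof. by rewrite /polygonal_length big_geq. Qed.

Lemma mdist_le_curve_length a b c : a <= b ->
  ((mdist (c a) (c b))%:E <= curve_length a b c)%E.
Proof.
rewrite le_eqVlt => /predU1P[<-|ab]; apply: ereal_sup_ubound => /=.
  by exists [::]; [split=> /= | rewrite polygonal_length_nil mdistxx].
exists [:: b]; first exact: itv_partition1.
by rewrite polygonal_length_cons polygonal_length_nil addr0.
Qed.

Lemma polygonal_length_le a b c lam p :
  (forall s t, s <= t -> mdist (c s) (c t) <= lam * (t - s)) ->
  itv_partition a b p -> polygonal_length a b c p <= lam * (b - a).
Proof.
move=> clip; elim: p a => [|x p IHp] a.
  by move=> /itv_partition_nil ->; rewrite polygonal_length_nil subrr mulr0.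
move=> abp; have [/= /andP[ax _] _] := abp.
rewrite polygonal_length_cons.
rewrite (_ : b - a = (x - a) + (b - x)) 1?mulrDr; last by ring.
by apply: lerD; [exact/clip/ltW | exact/IHp/(itv_partition_cons abp)].
Qed.

(** Cutting [a, b] into steps of length [h] loses no length.  The induction is
    on the number [n] of steps needed. *)
Lemma exists_exact_polygon a b c lam h : 0 < h -> a <= b ->
  (forall s t, s <= t -> t <= s + h -> mdist (c s) (c t) = lam * (t - s)) ->
  exists2 p, itv_partition a b p & polygonal_length a b c p = lam * (b - a).
Proof.
move=> h0 ab ciso.
have [n abn] : exists n, b - a <= n%:R * h.
  exists (Num.bound ((b - a) / h)); rewrite -ler_pdivrMr//.
  by rewrite ltW// archi_boundP// divr_ge0 ?subr_ge0// ltW.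
elim: n a ab abn => [a ab|n IHn a ab abn].
  rewrite mul0r subr_le0 => ba; have -> : a = b by apply/le_anti/andP.
  by exists [::]; [split=> /= | rewrite polygonal_length_nil subrr mulr0].
have [bah|ahb] := leP b (a + h).
  move: ab; rewrite le_eqVlt => /predU1P[ab|ab].
    by rewrite ab; exists [::];
      [split=> /= | rewrite polygonal_length_nil subrr mulr0].
  exists [:: b]; first exact: itv_partition1.
  by rewrite polygonal_length_cons polygonal_length_nil addr0 ciso// ltW.
have [|p [pp pl] plen] := IHn _ (ltW ahb).
  by move: abn; rewrite -natr1 mulrDl mul1r; lra.
exists (a + h :: p); first by split=> //=; rewrite ltrDl h0.
by rewrite polygonal_length_cons plen ciso//; [ring | rewrite lerDl ltW].
Qed.

Lemma curve_length_local_geodesic a b c lam h : 0 < h -> a <= b ->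
  (forall s t, s <= t -> mdist (c s) (c t) <= lam * (t - s)) ->
  (forall s t, s <= t -> t <= s + h -> mdist (c s) (c t) = lam * (t - s)) ->
  curve_length a b c = (lam * (b - a))%:E.
Proof.
move=> h0 ab clip ciso; apply/le_anti/andP; split.
  by apply: ge_ereal_sup => _ [p abp <-]; rewrite lee_fin polygonal_length_le.
have [p abp <-] := exists_exact_polygon h0 ab ciso.
by apply: ereal_sup_ubound; exists p.
Qed.

End CurveLength.

(** * 1/k geodesics through their pseudometric *)

(** The trace that a [1/k] geodesic of length [l] leaves on the parameter line
    once the ambient space is forgotten.  It is a condition on a bare function
    [rho], so that traces of curves in different spaces can be compared. *)
Definition short_geodesic_pseudometric {R : realType} (k : nat) (l : R)
    (rho : R -> R -> R) : Prop :=
  [/\ forall t, rho t (t + 2 * pi) = 0,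
      forall s t, s <= t -> rho s t <= l / (2 * pi) * (t - s)
    & forall s t, s <= t -> t <= s + 2 * pi / k%:R ->
        rho s t = l / (2 * pi) * (t - s)].

Section Spectrum.
Context {R : realType} {M : metricType R}.
Implicit Types (k : nat) (l : R) (g : R -> M).

Definition pullback_dist g (s t : R) : R := mdist (g s) (g t).

(** From [s] to [s + 2 pi / k] the curve is as long as the distance of its
    ends, so the triangle inequality through an intermediate time [t] leaves no
    room for the part from [s] to [t] to be longer than the distance of its
    own ends. *)
Lemma short_geodesic_of_one_kth k l g : (0 < k)%N ->
  one_kth_geodesic k g -> loop_length g = l%:E ->
  short_geodesic_pseudometric k l (pullback_dist g).
Proof.
move=> k0 [[_ gper _ _ gspeed] gk] gl.
have pi0 : (0 : R) < pi := pi_gt0 R.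
have kR0 : 0 < k%:R :> R by rewrite ltr0n.
have lip s t : s <= t -> pullback_dist g s t <= l / (2 * pi) * (t - s).
  move=> st; rewrite -lee_fin.
  rewrite (_ : (l / (2 * pi) * (t - s))%:E = curve_length s t g).
    exact: mdist_le_curve_length.
  by rewrite gspeed// gl -EFinM; congr (_%:E); ring.
split=> // [t|s t st tsk]; first by rewrite /pullback_dist gper mdistxx.
have := gk s; rewrite gl -EFinM => -[] gsk.
apply/le_anti; rewrite lip//= -(lerD2r (pullback_dist g t (s + 2 * pi / k%:R))).
apply: le_trans (metric_triangle _ _ _); rewrite gsk.
apply: le_trans (lerD (lexx _) (lip _ _ tsk)) _.
rewrite -mulrDr le_eqVlt; apply/orP; left; apply/eqP.
by move: (pi : R) pi0 => p p0; field; rewrite !lt0r_neq0.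
Qed.

(** The local equality computes the length of every arc
    ([curve_length_local_geodesic]); an arc of parameter length at most
    [2 pi / k] is then as long as the distance of its ends, hence minimizing.
    When [k = 1] the equality at [t = s + 2 pi] contradicts periodicity, in
    accordance with the fact that the spectrum is then empty. *)
Lemma one_kth_of_short_geodesic k l g : (0 < k)%N -> 0 < l ->
  short_geodesic_pseudometric k l (pullback_dist g) ->
  one_kth_geodesic k g /\ loop_length g = l%:E.
Proof.
move=> k0 l0 [gper glip giso].
have pi0 : (0 : R) < pi := pi_gt0 R.
have kR0 : 0 < k%:R :> R by rewrite ltr0n.
have h0 : 0 < 2 * pi / k%:R :> R by rewrite divr_gt0// mulr_gt0.
have lam0 : 0 < l / (2 * pi) by rewrite divr_gt0// mulr_gt0.
have glen s t : s <= t -> curve_length s t g = (l / (2 * pi) * (t - s))%:E.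
  by move=> st; apply: curve_length_local_geodesic h0 st glip giso.
have gl : loop_length g = l%:E.
  rewrite /loop_length glen ?mulr_ge0 ?ltW//; congr (_%:E).
  by move: (pi : R) pi0 => p p0; field; rewrite !lt0r_neq0.
have gk t : pullback_dist g t (t + 2 * pi / k%:R) = l / k%:R.
  rewrite giso ?lexx// ?lerDl ?ltW//.
  by move: (pi : R) pi0 => p p0; field; rewrite !lt0r_neq0.
split; last by [].
split; last by move=> t; rewrite gl -EFinM -(gk t).
split.
- move=> t; apply/metricType_numDomainType.cvgrPdist_lt => e e0.
  have d0 : 0 < e / (l / (2 * pi)) by rewrite divr_gt0.
  apply: filterS (nbhsx_ballx t _ d0) => s /=.
  rewrite /ball /= ltr_pdivlMr// => ts.
  have [st|/ltW st] := leP t s.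
    apply: le_lt_trans (glip _ _ st) _.
    by rewrite mulrC -[s - t]ger0_norm ?subr_ge0// distrC.
  rewrite metric_sym; apply: le_lt_trans (glip _ _ st) _.
  by rewrite mulrC -[t - s]ger0_norm ?subr_ge0.
- by move=> t; apply/esym/mdist_positivity/gper.
- exists 0, (0 + 2 * pi / k%:R) => g0.
  have := gk 0; rewrite /pullback_dist -g0 mdistxx => /esym/eqP.
  by rewrite gt_eqF// divr_gt0.
(* Half of [2 pi / k], since the arc extends to both sides of [t]. *)
- move=> t; exists (pi / k%:R) => [|u v c uv _ cu cv]; first by rewrite divr_gt0.
  have e0 : 0 < pi / k%:R :> R by rewrite divr_gt0.
  have te : t - pi / k%:R <= t + pi / k%:R by lra.
  rewrite glen// -giso//; last by rewrite mulrAC; lra.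
  by rewrite /pullback_dist -cu -cv mdist_le_curve_length.
- by move=> s t st; rewrite glen// gl -EFinM; congr (_%:E); ring.
Qed.

Lemma one_kth_length_spectrumP k l : (0 < k)%N -> 0 < l ->
  one_kth_length_spectrum k M l <->
  exists g : R -> M, short_geodesic_pseudometric k l (pullback_dist g).
Proof.
move=> k0 l0; split=> [[g gk gl]|[g /(one_kth_of_short_geodesic k0 l0)[gk gl]]].
  by exists g; exact: short_geodesic_of_one_kth.
by exists g.
Qed.

End Spectrum.

(** * Limits of 1/k geodesics *)

(** Send each point of [X] to a point of [Y] that is closer than [r] to it in a
    common ambient space. *)
Lemma GH_dist_approximation {R : realType} (X Y : metricType R) (r : R) :
  (GH_dist X Y < r%:E)%E ->
  exists h : X -> Y, forall x x', `|mdist (h x) (h x') - mdist x x'| <= 2 * r.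
Proof.
move=> /ereal_inf_lt[_ [Z [f [g [fiso giso ->]]]]].
move=> /ereal_inf_lt[_ [r' [_ fg _] <-]]; rewrite lte_fin => r'r.
have /choice[h hP] : forall x, exists y, mdist (g y) (f x) < r'.
  move=> x; have [|_ [y _ <-]] := fg (f x); first by exists x.
  by rewrite ballEmdist => /= ?; exists y.
exists h => x x'; rewrite -fiso -giso.
have := hP x; have := hP x'.
have := metric_triangle (g (h x)) (f x) (g (h x')).
have := metric_triangle (f x) (f x') (g (h x')).
have := metric_triangle (f x) (g (h x)) (f x').
have := metric_triangle (g (h x)) (g (h x')) (f x').
rewrite (metric_sym (f x) (g (h x))) (metric_sym (f x') (g (h x'))).
by rewrite ler_norml => *; apply/andP; split; lra.
Qed.

(** The image of an ultrafilter decides every set, so a cluster point of it is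
    a limit. *)
Lemma compact_ultrafilter_cvg {I : Type} {T : topologicalType}
    (F : set_system I) (h : I -> T) :
  UltraFilter F -> compact [set: T] -> exists x : T, h @ F --> x.
Proof.
move=> FU Tco; have [|x [_ hx]] := Tco (h @ F) _; first exact: filterT.
exists x => V Vx; have [//|nV] := in_ultra_setVsetC (h @^-1` V) FU.
by have [y [/=]] := hx (~` V) V nV Vx.
Qed.

Lemma cvg_mdist {R : realType} {I : Type} {M : metricType R}
    {F : set_system I} {FF : Filter F} (f g : I -> M) (x y : M) :
  f @ F --> x -> g @ F --> y ->
  (fun i => mdist (f i) (g i)) @ F --> mdist x y.
Proof.
move=> fx gy; apply/cvgrPdist_lt => e e0.
have e20 : 0 < e / 2 by rewrite divr_gt0.
near=> i.
have fxi : mdist x (f i) < e / 2.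
  by near: i; exact: metricType_numDomainType.cvgr_dist_lt fx _ e20.
have gyi : mdist y (g i) < e / 2.
  by near: i; exact: metricType_numDomainType.cvgr_dist_lt gy _ e20.
have := metric_triangle x (f i) y; have := metric_triangle (f i) (g i) y.
have := metric_triangle (f i) x (g i); have := metric_triangle x y (g i).
rewrite (metric_sym (f i) x) (metric_sym (g i) y).
by rewrite ltr_norml => *; apply/andP; split; lra.
Unshelve. all: by end_near. Qed.

(** Convergence of the lengths comes with that of the pseudometrics, because
    [l_ i] is [k] times the distance from [0] to [2 pi / k]. *)
Lemma short_geodesic_limit {R : realType} {I : Type} (F : set_system I)
    (k : nat) (l_ : I -> R) (rho_ : I -> R -> R -> R) (rho : R -> R -> R) :
  ProperFilter F -> (0 < k)%N ->
  (forall i, short_geodesic_pseudometric k (l_ i) (rho_ i)) ->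
  (forall s t, (fun i => rho_ i s t) @ F --> rho s t) ->
  exists2 l, l_ @ F --> l & short_geodesic_pseudometric k l rho.
Proof.
move=> FF k0 geo_ rhoP.
have pi0 : (0 : R) < pi := pi_gt0 R.
have kR0 : 0 < k%:R :> R by rewrite ltr0n.
have h0 : 0 < 2 * pi / k%:R :> R by rewrite divr_gt0// mulr_gt0.
have l_E : l_ = fun i => k%:R * rho_ i 0 (2 * pi / k%:R).
  apply/funext => i; have [_ _ ->] := geo_ i; rewrite ?add0r ?lexx ?ltW//.
  by move: (pi : R) pi0 => p p0; field; rewrite !lt0r_neq0.
have l_cvg : l_ @ F --> k%:R * rho 0 (2 * pi / k%:R).
  by rewrite l_E; apply: cvgM; [exact: cvg_cst | exact: rhoP].
exists (k%:R * rho 0 (2 * pi / k%:R)) => //; set l := (X in l_ @ F --> X) in l_cvg *.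
have lin_cvg s t :
    (fun i => l_ i / (2 * pi) * (t - s)) @ F --> l / (2 * pi) * (t - s).
  by apply: cvgM; [apply: cvgM => // |]; exact: cvg_cst.
split=> [t|s t st|s t st tsk].
- have : (fun i => rho_ i t (t + 2 * pi)) @ F --> (0 : R).
    rewrite (_ : (fun=> _) = fun=> 0); first exact: cvg_cst.
    by apply/funext => i; have [->] := geo_ i.
  by apply: norm_cvg_unique (rhoP t (t + 2 * pi)).
- rewrite -subr_ge0; apply: cvgr_to_ge (cvgB (lin_cvg s t) (rhoP s t)) _.
  by near=> i; rewrite subr_ge0; have [_ ->] := geo_ i.
- have := rhoP s t.
  rewrite (_ : (fun=> _) = fun i => l_ i / (2 * pi) * (t - s)).
    by move=> rho_lin; apply: norm_cvg_unique rho_lin (lin_cvg s t).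
  by apply/funext => i; have [_ _ ->] := geo_ i.
Unshelve. all: by end_near. Qed.

Theorem theorem8p1 (R : realType) (M : metricType R) (eps : R) (k : nat)
    (hM : compact_length_space M) (heps : 0 < eps) (hk : (0 < k)%N) :
  exists2 delta : R, 0 < delta &
    forall a b : R, 0 <= a -> a < b ->
      `]a, b[%classic `&` one_kth_length_spectrum k M = set0 ->
      forall N : metricType R, compact_length_space N ->
        (GH_dist N M < delta%:E)%E ->
        `[a + eps, b - eps]%classic `&` one_kth_length_spectrum k N = set0.
Proof.
apply: contrapT => nodelta.
have /choice[u uP] (n : nat) : exists u : R * (R -> R -> R) * (R -> M),
    let: (l, rho, h) := u in
    [/\ eps <= l, short_geodesic_pseudometric k l rho,
      forall l', `|l' - l| < eps -> ~ one_kth_length_spectrum k M l'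
    & forall s t, `|pullback_dist h s t - rho s t| <= 2 * n.+1%:R^-1].
  apply: contrapT => nou; apply: nodelta.
  (* Both ends of the gap are at distance at least [eps] from [l], and
     [0 <= a] gives [eps <= l]. *)
  exists n.+1%:R^-1 => [|a b a0 ab gap N _ NM]; first by rewrite invr_gt0.
  rewrite -subset0 => l [/=]; rewrite in_itv/= => /andP[al lb] [g gk gl].
  have [h hP] := GH_dist_approximation NM.
  apply: nou; exists (l, pullback_dist g, h \o g); split.
  - by lra.
  - exact: short_geodesic_of_one_kth.
  - move=> l'; rewrite ltr_norml => /andP[ll' l'l] Ml'.
    rewrite -subset0 in gap; apply: (gap l'); split=> //=.
    by rewrite in_itv/=; apply/andP; split; lra.
  - by move=> s t; exact: hP.
(* One ultrafilter makes [h_n t] converge for all times [t] at once. *)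
have [F [FU Foo]] := ultraFilterLemma eventually_filter.
have FF : ProperFilter F by exact: ultra_proper.
pose l_ n := (u n).1.1; pose rho_ n := (u n).1.2; pose h_ n := (u n).2.
have {uP} uP n : [/\ eps <= l_ n, short_geodesic_pseudometric k (l_ n) (rho_ n),
      forall l', `|l' - l_ n| < eps -> ~ one_kth_length_spectrum k M l'
    & forall s t, `|pullback_dist (h_ n) s t - rho_ n s t| <= 2 * n.+1%:R^-1].
  by have := uP n; rewrite /l_ /rho_ /h_; case: (u n) => -[].
have /choice[g gP] t : exists x : M, (fun n => h_ n t) @ F --> x.
  exact: compact_ultrafilter_cvg (proj1 hM).
have err0 : (fun n => 2 * n.+1%:R^-1 : R) @ F --> (0 : R).
  apply: cvg_trans (cvg_app _ Foo) _.
  by rewrite -[0](mulr0 2); apply: cvgM; [exact: cvg_cst | exact: cvg_harmonic].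
have rhoP s t : (fun n => rho_ n s t) @ F --> pullback_dist g s t.
  have diff0 : (fun n => pullback_dist (h_ n) s t - rho_ n s t) @ F --> (0 : R).
    apply/norm_cvg0P; apply: squeeze_cvgr (cvg_cst 0) err0.
    by near=> n; rewrite normr_ge0; have [_ _ _ ->] := uP n.
  rewrite (_ : (fun n => rho_ n s t) = (fun n => pullback_dist (h_ n) s t) \-
      (fun n => pullback_dist (h_ n) s t - rho_ n s t)).
    rewrite -[pullback_dist g s t]subr0.
    exact: cvgB (cvg_mdist (gP s) (gP t)) diff0.
  by apply/funext => n; rewrite /= subKr.
have geo_ n : short_geodesic_pseudometric k (l_ n) (rho_ n) by have [] := uP n.
have [l l_cvg geo] := short_geodesic_limit FF hk geo_ rhoP.
have epsl : eps <= l.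
  by apply: cvgr_to_ge l_cvg _; near=> n; have [] := uP n.
have Ml : one_kth_length_spectrum k M l.
  by apply/one_kth_length_spectrumP => //; [lra | exists g].
have /cvgrPdist_lt/(_ _ heps)/filter_ex[n ln] := l_cvg.
by have [_ _ /(_ l ln)] := uP n.
Unshelve. all: by end_near. Qed.
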